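(* Let $X$ be a conical Hamiltonian symplectic resolution over a field $k$ of characteristic $p>0$ with Hamiltonian torus $T$, let $\mathcal{X}$ be its universal deformation and $\mathcal{A}$ the global sections of its canonical quantization. Assume that there is a Frobenius-constant quantization $\Lambda:\mathcal{O}(\mathcal{X})^{(1)}\to Z(\mathcal{A})$, mapping $T$-weight $\lambda$ to $T$-weight $p\lambda$. Then for every $a\in\mathcal{O}(\mathcal{X})_0$ (an element of $T$-weight zero), left multiplication by $\Lambda(a)$, $z^\mu\otimes b\mapsto z^\mu\otimes\Lambda(a)b$, is a well-defined endomorphism of the $D$-module of twisted traces $M_{eq}=\mathscr{B}(\mathcal{A})$, and it is covariantly constant (central), i.e. it commutes with the action of the ring of differential operators $R_{eq}$.
   Context: A symplectic resolution over $k$ is a projective birational Poisson morphism $X\to Y$ with $X$ smooth symplectic and $Y$ affine, normal, Poisson. It is conical if $\mathcal{O}(X)=\bigoplus_{n\ge0}\mathcal{O}(X)^n$ with $\mathcal{O}(X)^0=k$, $\mathcal{O}(X)^1=0$ and Poisson bracket of degree $-2$; Hamiltonian if a split torus $T$ acts faithfully by Poisson automorphisms, inducing a weight grading by $X^\bullet(T)=\mathrm{Hom}(T,\mathbb{G}_m)$; conical Hamiltonian if $T$ commutes with the conical $\mathbb{G}_m$-action and $\mathfrak{t}=\mathrm{Lie}(T)$ is identified with a Cartan subalgebra of the Lie algebra $\mathcal{O}(X)^2$ (so $\mathcal{O}(X)_0^2\cong\mathfrak{t}$). The universal Poisson deformation $\mathcal{X}\to H^2(X)$ and its quantization are assumed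 to exist. $\mathcal{A}$ is an associative algebra, flat over $k[\hbar]$, with $\mathcal{A}/\hbar\cong\mathcal{O}(\mathcal{X})$, bigraded as $\mathcal{A}=\bigoplus\mathcal{A}^n_\lambda$ by conical degree $n$ and weight $\lambda\in X^\bullet(T)$; likewise $\mathcal{O}(\mathcal{X})=\bigoplus\mathcal{O}(\mathcal{X})^n_\lambda$. For $a\in\mathcal{A}_0^2$, $\bar a\in\mathfrak{t}$ denotes its image under $\mathcal{A}^2_0\to\mathcal{O}(X)_0^2\cong\mathfrak{t}$, and $[a,b]=\hbar\langle\lambda,\bar a\rangle b$ for $b\in\mathcal{A}_\lambda$. The kernel of $\mathcal{A}^2_0\to\mathfrak t$ is $H_2(X;k)\oplus k\hbar$. Frobenius-constant quantization: with $M^{(1)}=M\otimes_{k,\mathrm{Fr}}k$, it is an algebra map $\Lambda:\mathcal{O}(\mathcal{X})^{(1)}\to Z(\mathcal{A})$ with central image and $\Lambda(f)\equiv f^p$ mod $\hbar^{p-1}$; here $\Lambda(\mathcal{O}(\mathcal{X})_\lambda)\subset\mathcal{A}_{p\lambda}$. Fix a cocharacter $\sigma:\mathbb{G}_m\to T$. Let $\mathcal{A}^+\subset\mathcal{A}$ be the two-sided ideal of elements of positive conical degree; $\Sigma_{eq}$ is the set of $T$-weights of $\mathcal{A}^+/(\mathcal{A}^+\cdot\mathcal{A}^+)$ and $\Sigma_{eq,+}=\{\lambda\in\Sigma_{eq}:\langle\sigma,\lambda\rangle>0\}$. Set $R_{eq}=k[z^\mu:\mu\in\mathbb{Z}_{\ge0}\Sigma_{eq,+}]\otimes\mathrm{Sym}\,\mathcal{A}_0^2$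 with relations $az^\mu=z^\mu(a+\hbar\langle\mu,\bar a\rangle)$. The $D$-module of twisted traces is the left $R_{eq}$-module $$M_{eq}=\mathscr{B}(\mathcal{A})=k[z^\mu:\mu\in\mathbb{Z}_{\ge0}\Sigma_{eq,+}]\otimes\mathcal{A}_0/\{1\otimes ab-z^\lambda\otimes ba:\ a\in\mathcal{A}_\lambda,\ b\in\mathcal{A}_{-\lambda}\}$$ (quotient by the $k[z^\mu]$-submodule generated by these elements, $\lambda\in\mathbb{Z}_{\ge0}\Sigma_{eq,+}$), with action $(z^\mu\otimes a)\cdot(z^\lambda\otimes b)=z^{\lambda+\mu}\otimes(a+\hbar\langle\lambda,\bar a\rangle)b$ for $a\in\mathcal{A}_0^2$. *)

(* Defs.v *)
From HB Require Import structures.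
From mathcomp Require Import all_boot all_order all_algebra.
From mathcomp Require Import boolp classical_sets topology_structure.
From mathcomp Require Import finmap monalg.
Import Order.TTheory GRing.Theory Num.Theory.
Set Implicit Arguments. Unset Strict Implicit. Unset Printing Implicit Defensive.
Local Open Scope ring_scope.
Local Open Scope classical_set_scope.
Local Open Scope quotient_scope.

(* Finite sums of elements of S. *)
Definition addspan (V : nmodType) (S : set V) : set V :=
  [set v | exists2 s : seq V, (forall x, x \in s -> S x) & v = \sum_(x <- s) x].

Lemma addspan0 (V : nmodType) (S : set V) : addspan S 0.
Proof. by exists [::] => //; rewrite big_nil. Qed.

Lemma addspanD (V : nmodType) (S : set V) x y :
  addspan S x -> addspan S y -> addspan S (x + y).
Proof.
move=> [s hs ->] [t ht ->]; exists (s ++ t); last by rewrite big_cat.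
by move=> z; rewrite mem_cat => /orP[/hs|/ht].
Qed.

Lemma addspan_ind (V : nmodType) (S P : set V) :
  P 0 -> (forall x y, S x -> P y -> P (x + y)) -> addspan S `<=` P.
Proof.
move=> P0 PD _ [s hs ->]; elim: s hs => [|x s IH] hs; first by rewrite big_nil.
rewrite big_cons; apply: PD; first by apply: hs; rewrite mem_head.
by apply: IH => y ys; apply: hs; rewrite in_cons ys orbT.
Qed.

Lemma addspan_map (V W : nmodType) (f : V -> W) (S : set V) (S' : set W) :
  nmod_morphism f -> (forall x, S x -> addspan S' (f x)) ->
  forall x, addspan S x -> addspan S' (f x).
Proof.
move=> [f0 fD] h; apply: (@addspan_ind V S (fun x => addspan S' (f x))).
  by rewrite f0; exact: addspan0.
by move=> x y Sx Sy; rewrite fD; apply: addspanD => //; exact: h.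
Qed.

Record direct_sum (I : eqType) (V : zmodType) (G : I -> set V) : Prop := {
  ds_0 : forall i, G i 0;
  ds_B : forall i x y, G i x -> G i y -> G i (x - y);
  ds_span : forall v, exists (s : seq I) (c : I -> V),
    (forall i, G i (c i)) /\ v = \sum_(i <- s) c i;
  ds_free : forall (s : seq I) (c : I -> V), uniq s -> (forall i, G i (c i)) ->
    \sum_(i <- s) c i = 0 -> forall i, i \in s -> c i = 0 }.

(* Flatness by the equational criterion. *)
Definition flat (P : comNzRingType) (M : zmodType) (act : P -> M -> M) :=
  forall n (r : 'I_n -> P) (m : 'I_n -> M),
    \sum_i act (r i) (m i) = 0 ->
    exists q (B : 'I_n -> 'I_q -> P) (y : 'I_q -> M),
      (forall i, m i = \sum_j act (B i j) (y j)) /\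
      (forall j, \sum_i r i * B i j = 0).

Notation lattice r := 'rV[int]_r.

Definition pair_lie (k : fieldType) r (l : lattice r) (t : 'rV[k]_r) : k :=
  \sum_i (l 0 i)%:~R * t 0 i.
Definition pair_cochar r (s l : lattice r) : int := \sum_i s 0 i * l 0 i.

Record bigradedAlgebra (k : fieldType) (r : nat) := BigradedAlgebra {
  ba_car :> algType k;
  hgr : nat -> lattice r -> set ba_car;
  hgr_sum : direct_sum (fun i : nat * lattice r => hgr i.1 i.2);
  hgrZ : forall n l c x, hgr n l x -> hgr n l (c *: x);
  hgr1 : hgr 0 0 1;
  hgrM : forall m n l l' x y,
    hgr m l x -> hgr n l' y -> hgr (m + n) (l + l') (x * y) }.

Definition hwt k r (A : bigradedAlgebra k r) (l : lattice r) : set A :=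
  addspan [set x | exists n, hgr n l x].

(* hmom a is the image of a in Lie T, and is meaningful for a of bidegree (2, 0)
   only. *)
Record hamAlgebra (k : fieldType) (r : nat) := HamAlgebra {
  ha_car :> bigradedAlgebra k r;
  hbar : ha_car;
  hmom : ha_car -> 'rV[k]_r;
  hbar_gr : hgr 2 0 hbar;
  hbar_central : forall x, hbar * x = x * hbar;
  hmom_lin : forall c (a b : ha_car), hgr 2 0 a -> hgr 2 0 b ->
    hmom (c *: a + b) = c *: hmom a + hmom b;
  hmom_hbar : hmom hbar = 0;
  hmom_comm : forall l (a b : ha_car), hgr 2 0 a -> hwt l b ->
    a * b - b * a = pair_lie l (hmom a) *: (hbar * b) }.

(* Sheaves are indexed by opens; the set of points is used for inclusions and the
   coercion to functions for membership. *)
Record opens (T : topologicalType) := Opens {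
  oset :> set T;
  oset_open : open oset }.
Definition oin (T : topologicalType) (U : opens T) : T -> Prop := oset U.
Coercion oin : opens >-> Funclass.

Definition fullO (T : topologicalType) : opens T := Opens openT.
Arguments fullO {T}.

Lemma sub_full (S T : topologicalType) (f : S -> T) (V : opens S) :
  V `<=` f @^-1` (fullO : opens T).
Proof. by []. Qed.

Lemma le_full (T : topologicalType) (V : opens T) : V `<=` (fullO : opens T).
Proof. by []. Qed.

Section Schemes.
Variable k : fieldType.

Record ringedSpace := RingedSpace {
  rs_space :> topologicalType;
  sec : opens rs_space -> comPzRingType;
  cst : forall U, {rmorphism k -> sec U};
  res : forall U V : opens rs_space, V `<=` U -> {rmorphism sec U -> sec V};
  res_cst : forall (U V : opens rs_space) (h : V `<=` U) c,
    res h (cst U c) = cst V c;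
  res_id : forall (U : opens rs_space) (h : U `<=` U) s, res h s = s;
  res_comp : forall (U V W : opens rs_space) (hV : V `<=` U) (hW : W `<=` V)
    (h : W `<=` U) s, res hW (res hV s) = res h s;
  sec_glue : forall (I : Type) (U : I -> opens rs_space) (V : opens rs_space)
    (le : forall i, U i `<=` V) (s : forall i, sec (U i)),
    V = \bigcup_i U i :> set rs_space ->
    (forall i j (W : opens rs_space) (hi : W `<=` U i) (hj : W `<=` U j),
       res hi (s i) = res hj (s j)) ->
    exists! t : sec V, forall i, res (le i) t = s i }.

(* The points of U at which f is invertible. *)
Definition basic (X : ringedSpace) (U : opens X) (f : sec U) : set X :=
  [set x | exists (V : opens X) (h : V `<=` U) (g : sec V),
     V x /\ res h f * g = 1].

Definition prime_ideal (R : comPzRingType) (P : set R) :=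
  [/\ P 0, forall a b, P a -> P b -> P (a + b), forall a b, P b -> P (a * b),
      ~ P 1 & forall a b, P (a * b) -> P a \/ P b].

(* U is affine when the canonical map x |-> {f | f vanishes at x} from U to the
   spectrum of sec U is a homeomorphism, and sections over a basic open set are
   the localization. *)
Definition affine (X : ringedSpace) (U : opens X) :=
  [/\ forall x, U x -> prime_ideal [set f : sec U | ~ basic f x],
      forall P : set (sec U), prime_ideal P ->
        exists! x, U x /\ P = [set f : sec U | ~ basic f x],
      forall (V : opens X) x, V x -> U x ->
        exists f : sec U, basic f x /\ basic f `<=` V
    & forall (f : sec U) (D : opens X) (h : D `<=` U), D = basic f :> set X ->
        (forall s : sec D, exists n a, res h a = res h (f ^+ n) * s) /\
        (forall a, res h a = 0 -> exists n, f ^+ n * a = 0)].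

Record scheme := Scheme {
  sch_rs :> ringedSpace;
  sch_affine : forall x : sch_rs, exists U : opens sch_rs, U x /\ affine U }.

(* pull is indexed by all V lying over U, and not only by the preimage of U, so
   that equality and composition of morphisms can be stated without transport. *)
Record mor (X Y : scheme) := Mor {
  mfun :> X -> Y;
  mor_cont : continuous mfun;
  pull : forall (U : opens Y) (V : opens X), V `<=` mfun @^-1` U ->
    {rmorphism sec U -> sec V};
  pull_cst : forall (U : opens Y) (V : opens X) (h : V `<=` mfun @^-1` U) c,
    pull h (cst U c) = cst V c;
  pull_res : forall (U U' : opens Y) (V V' : opens X)
    (h : V `<=` mfun @^-1` U) (h' : V' `<=` mfun @^-1` U')
    (hU : U' `<=` U) (hV : V' `<=` V) s,
    pull h' (res hU s) = res hV (pull h s);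
  mor_local : forall (U : opens Y) (V : opens X) (h : V `<=` mfun @^-1` U)
    (f : sec U) x, V x -> basic (pull h f) x -> basic f (mfun x) }.

Definition pullT (X Y : scheme) (f : mor X Y) :
    {rmorphism sec (fullO : opens Y) -> sec (fullO : opens X)} :=
  pull (@sub_full X Y f fullO).

Definition mor_eq (X Y : scheme) (f g : mor X Y) :=
  (forall x, f x = g x) /\
  forall (U : opens Y) (V : opens X) (hf : V `<=` f @^-1` U)
    (hg : V `<=` g @^-1` U) s, pull hf s = pull hg s.

Definition is_comp (X Y Z : scheme) (f : mor X Y) (g : mor Y Z) (h : mor X Z) :=
  (forall x, h x = g (f x)) /\
  forall (W : opens Z) (V : opens Y) (U : opens X) (hf : U `<=` f @^-1` V)
    (hg : V `<=` g @^-1` W) (hh : U `<=` h @^-1` W) s,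
    pull hh s = pull hf (pull hg s).

Definition ring_generated (R : comPzRingType) (S : set R) :=
  forall T : set R, S `<=` T -> T 1 ->
    (forall a b, T a -> T b -> T (a - b)) ->
    (forall a b, T a -> T b -> T (a * b)) -> forall a, T a.

Definition finite_type (X : scheme) (U : opens X) :=
  exists n (g : 'I_n -> sec U), ring_generated (range (cst U) `|` range g).

Definition formally_smooth (X : scheme) (U : opens X) :=
  forall (C C' : comPzRingType) (i : {rmorphism k -> C}) (q : {rmorphism C -> C'}),
    (forall c', exists c, q c = c') ->
    (forall a b, q a = 0 -> q b = 0 -> a * b = 0) ->
    forall f : {rmorphism sec U -> C'}, (forall c, f (cst U c) = q (i c)) ->
    exists g : {rmorphism sec U -> C},
      (forall c, g (cst U c) = i c) /\ forall a, q (g a) = f a.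

Definition smooth (X : scheme) := forall x : X, exists U : opens X,
  [/\ U x, affine U, finite_type U & formally_smooth U].

Definition domain (R : comPzRingType) :=
  1 != 0 :> R /\ forall a b : R, a * b = 0 -> a = 0 \/ b = 0.

Definition integral_scheme (X : scheme) :=
  (exists x : X, True) /\
  forall U : opens X, (exists x, U x) -> domain (sec U).

(* The fraction a / b is integral over R, with denominators cleared. *)
Definition integrally_closed (R : comPzRingType) :=
  domain R /\
  forall (a b : R) n (c : 'I_n -> R), b != 0 ->
    a ^+ n + \sum_i c i * a ^+ i * b ^+ (n - i) = 0 -> exists d, a = b * d.

(* A closed immersion of X into projective n-space over the affine scheme Y:
   U i is the locus where the i-th homogeneous coordinate s_i is invertible,
   and t i j = s_j / s_i. *)
Definition projective (X Y : scheme) (f : mor X Y) :=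
  exists n (U : 'I_n.+1 -> opens X) (t : forall i, 'I_n.+1 -> sec (U i)),
  [/\ forall x, exists i, U i x,
      forall i, affine (U i) /\ t i i = 1,
      forall i j, basic (t i j) = U i `&` U j,
      forall i j l (W : opens X) (hi : W `<=` U i) (hj : W `<=` U j),
        res hi (t i l) = res hi (t i j) * res hj (t j l)
    & forall i, ring_generated
        (range (pull (@sub_full X Y f (U i))) `|` range (t i))].

Definition birational (X Y : scheme) (f : mor X Y) :=
  exists (U : opens X) (V : opens Y),
  [/\ exists x, U x,
      U `<=` f @^-1` V /\ forall y, V y -> exists! x, U x /\ f x = y,
      forall W : opens X, W `<=` U ->
        exists W' : opens Y, W = U `&` f @^-1` W' :> set X
    & forall (W : opens Y) (W' : opens X) (h : W' `<=` f @^-1` W),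
        W `<=` V -> W' = U `&` f @^-1` W :> set X -> bijective (pull h)].

Record poissonScheme := PoissonScheme {
  ps_sch :> scheme;
  br : forall U : opens ps_sch, sec U -> sec U -> sec U;
  brD : forall U (a b c : sec U), br (a + b) c = br a c + br b c;
  brZ : forall U s (a b : sec U), br (cst U s * a) b = cst U s * br a b;
  brxx : forall U (a : sec U), br a a = 0;
  br_leibniz : forall U (a b c : sec U), br a (b * c) = br a b * c + b * br a c;
  br_jacobi : forall U (a b c : sec U),
    br a (br b c) + br b (br c a) + br c (br a b) = 0;
  br_res : forall (U V : opens ps_sch) (h : V `<=` U) a b,
    res h (br a b) = br (res h a) (res h b) }.

Definition poisson_mor (X Y : poissonScheme) (f : mor X Y) :=
  forall (U : opens Y) (V : opens X) (h : V `<=` f @^-1` U) a b,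
    pull h (br a b) = br (pull h a) (pull h b).

Definition derivation (X : scheme) (U : opens X) (D : sec U -> sec U) :=
  [/\ forall a b, D (a + b) = D a + D b,
      forall a b, D (a * b) = D a * b + a * D b
    & forall c, D (cst U c) = 0].

Definition symplectic_form (X : scheme) (U : opens X)
    (w : (sec U -> sec U) -> (sec U -> sec U) -> sec U) :=
  let Der := @derivation X U in
  let lie D E := fun a : sec U => D (E a) - E (D a) in
  [/\ forall f D D' E, Der D -> Der D' -> Der E ->
        w (fun a => f * D a + D' a) E = f * w D E + w D' E,
      forall D, Der D -> w D D = 0,
      forall D E F, Der D -> Der E -> Der F ->
        D (w E F) + E (w F D) + F (w D E)
          - w (lie D E) F - w (lie E F) D - w (lie F D) E = 0
    & forall phi : (sec U -> sec U) -> sec U,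
        (forall f D E, Der D -> Der E ->
           phi (fun a => f * D a + E a) = f * phi D + phi E) ->
        exists! D, Der D /\ forall E, Der E -> w D E = phi E].

(* The Poisson bracket is inverse to a symplectic form w: {f, -} is the vector
   field with w({f, -}, D) = D f. *)
Definition symplectic (X : poissonScheme) :=
  forall U : opens X, affine U ->
  exists w, @symplectic_form X U w /\
    forall f D, derivation D -> w (br f) D = D f.

Record symplecticResolution := SymplecticResolution {
  sr_X :> poissonScheme;
  sr_Y : poissonScheme;
  sr_map : mor sr_X sr_Y;
  sr_poisson : poisson_mor sr_map;
  sr_proj : projective sr_map;
  sr_birat : birational sr_map;
  sr_integral : integral_scheme sr_X;
  sr_smooth : smooth sr_X;
  sr_symp : symplectic sr_X;
  sr_affine : affine (fullO : opens sr_Y);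
  sr_normal : integrally_closed (sec (fullO : opens sr_Y)) }.

(* The Z-points of the split torus with character lattice L are the group
   morphisms from L to the units of O(Z); the multiplicative group is L = int. *)
Definition torus_point (L : zmodType) (Z : scheme)
    (t : L -> sec (fullO : opens Z)) :=
  t 0 = 1 /\ forall a b, t (a + b) = t a * t b.

(* By the Yoneda lemma an action of the torus on X is an action of its Z-points
   on the Z-points of X that is natural in Z. *)
Record torusAction (L : zmodType) (X : scheme) := TorusAction {
  act : forall Z : scheme, (L -> sec (fullO : opens Z)) -> mor Z X -> mor Z X;
  act1 : forall (Z : scheme) (x : mor Z X), mor_eq (act (fun=> 1) x) x;
  actM : forall (Z : scheme) t u (x : mor Z X), torus_point t -> torus_point u ->
    mor_eq (act t (act u x)) (act (fun a => t a * u a) x);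
  act_nat : forall (W Z : scheme) (q : mor W Z) t (x : mor Z X) (y : mor W X),
    torus_point t -> is_comp q x y ->
    is_comp q (act t x) (act (fun a => pullT q (t a)) y) }.

Section Actions.
Variables (L : zmodType) (X : scheme) (T : torusAction L X).

Definition faithful := forall (Z : scheme) (t : L -> sec (fullO : opens Z)),
  torus_point t ->
  (forall (W : scheme) (q : mor W Z) (x : mor W X),
     mor_eq (act T (fun a => pullT q (t a)) x) x) ->
  forall a, t a = 1.

Definition stable (U : opens X) := forall (Z : scheme) t (x : mor Z X) z,
  torus_point t -> U (act T t x z) <-> U (x z).

Definition weight (U : opens X) (l : L) : set (sec U) :=
  [set f | forall (Z : scheme) t (x : mor Z X), torus_point t ->
     forall (h : (fullO : opens Z) `<=` x @^-1` U)
            (h' : (fullO : opens Z) `<=` act T t x @^-1` U),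
     pull h' f = t l * pull h f].

Definition weightT (l : L) : set (sec (fullO : opens X)) := @weight fullO l.
End Actions.
Arguments weight [L X] T U l _.

(* Tested on stable open sets, since sections over U need not have weights
   otherwise; a normal scheme with a torus action is covered by stable affines. *)
Definition bracket_weight L (X : poissonScheme) (T : torusAction L X) (w : L) :=
  forall U : opens X, stable T U -> forall l m f g,
    weight T U l f -> weight T U m g -> weight T U (l + m + w) (br f g).

Definition equivariant L (X Y : scheme) (S : torusAction L X)
    (T : torusAction L Y) (f : mor X Y) :=
  forall (Z : scheme) t (x : mor Z X) (y : mor Z Y), torus_point t ->
    is_comp x f y -> is_comp (act S t x) f (act T t y).

Definition commuting L M (X : scheme) (S : torusAction L X)
    (T : torusAction M X) :=
  forall (Z : scheme) t u (x : mor Z X), torus_point t -> torus_point u ->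
    mor_eq (act S t (act T u x)) (act T u (act S t x)).

Fixpoint lower_central (V : zmodType) (b : V -> V -> V) (h : set V) n : set V :=
  if n is n'.+1 then
    addspan [set z | exists x y, [/\ h x, lower_central b h n' y & z = b x y]]
  else h.

Definition cartan (V : zmodType) (b : V -> V -> V) (L h : set V) :=
  [/\ h `<=` L, forall x y, h x -> h y -> h (b x y),
      exists n, lower_central b h n `<=` [set 0]
    & forall x, L x -> (forall y, h y -> h (b x y)) -> h x].

Record conicalAction (X : poissonScheme) (T : torusAction int X) : Prop := {
  con_sum : direct_sum (weightT T);
  con_neg : forall n f, n < 0 -> weightT T n f -> f = 0;
  con_0 : forall f, weightT T 0 f -> exists c, f = cst _ c;
  con_1 : forall f, weightT T 1 f -> f = 0;
  con_br : bracket_weight T (-2) }.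

(* The torus T has rank r and character lattice Z^r, so that
   Lie T = Hom(Z^r, k) = k^r; ch_lie identifies O(X)^2_0 with Lie T. *)
Record conicalHamiltonian (r : nat) := ConicalHamiltonian {
  ch_res :> symplecticResolution;
  ch_con : torusAction int ch_res;
  ch_conP : conicalAction ch_con;
  ch_ham : torusAction (lattice r) ch_res;
  ch_faithful : faithful ch_ham;
  ch_br : bracket_weight ch_ham 0;
  ch_sum : direct_sum (weightT ch_ham);
  ch_comm : commuting ch_con ch_ham;
  ch_lie : sec (fullO : opens ch_res) -> 'rV[k]_r;
  ch_O20 : set (sec (fullO : opens ch_res)) :=
    weightT ch_con 2 `&` weightT ch_ham 0;
  ch_lie_lin : forall c f g, ch_O20 f -> ch_O20 g ->
    ch_lie (cst _ c * f + g) = c *: ch_lie f + ch_lie g;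
  ch_lie_inj : forall f, ch_O20 f -> ch_lie f = 0 -> f = 0;
  ch_lie_surj : forall t, exists2 f, ch_O20 f & ch_lie f = t;
  ch_lie_br : forall l f g, ch_O20 f -> weightT ch_ham l g ->
    br f g = cst _ (pair_lie l (ch_lie f)) * g;
  ch_cartan : cartan (@br ch_res fullO) (weightT ch_con 2) ch_O20 }.

Record conicalBase := ConicalBase {
  cb_alg :> comAlgType k;
  cb_gr : nat -> set cb_alg;
  cb_sum : direct_sum cb_gr;
  cb_mul : forall m n x y, cb_gr m x -> cb_gr n y -> cb_gr (m + n) (x * y);
  cb_0 : forall x, cb_gr 0 x <-> exists c, x = c%:A }.

Definition cb_plus (P : conicalBase) : set P :=
  addspan [set x | exists n, (0 < n)%N /\ cb_gr n x].

Section Deformations.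
Variables (X : poissonScheme) (T : torusAction int X).

(* A Poisson deformation of X over Spec P, with an action of the multiplicative
   group extending that on X: flat over P, with central fibre X cut out by the
   ideal generated by the positive part of P. *)
Record conicalDeformation (P : conicalBase) := ConicalDeformation {
  df_tot :> poissonScheme;
  df_act : torusAction int df_tot;
  df_br : bracket_weight df_act (-2);
  df_str : {rmorphism P -> sec (fullO : opens df_tot)};
  df_str_cst : forall c, df_str c%:A = cst _ c;
  df_str_wt : forall n a, cb_gr n a -> weightT df_act n%:Z (df_str a);
  df_str_br : forall (U : opens df_tot) a f,
    br (res (@le_full df_tot U) (df_str a)) f = 0;
  df_flat : forall U : opens df_tot, affine U ->
    flat (fun a (f : sec U) => res (@le_full df_tot U) (df_str a) * f);
  df_fib : mor X df_tot;
  df_fib_br : poisson_mor df_fib;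
  df_fib_eq : equivariant T df_act df_fib;
  df_fib_aff : forall (U : opens df_tot) (V : opens X),
    affine U -> V = df_fib @^-1` U :> set X ->
    affine V /\ forall h : V `<=` df_fib @^-1` U,
      (forall g, exists f, pull h f = g) /\
      (forall f, pull h f = 0 <->
         addspan [set z | exists a g, cb_plus a /\
           z = res (@le_full df_tot U) (df_str a) * g] f) }.

Definition classifies P R (D : conicalDeformation P) (E : conicalDeformation R)
    (chi : {rmorphism P -> R}) :=
  [/\ forall c, chi c%:A = c%:A, forall n a, cb_gr n a -> cb_gr n (chi a)
    & exists h : mor E D,
      [/\ poisson_mor h, equivariant (df_act E) (df_act D) h,
          forall a, pullT h (df_str D a) = df_str E (chi a)
        & is_comp (df_fib E) h (df_fib D)]].

(* Universality is tested on Artinian bases, and among conical deformations: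
   without the grading the Poisson deformation functor is too large in
   characteristic p, where de Rham cohomology is infinite-dimensional. *)
Definition universal P (D : conicalDeformation P) :=
  forall (R : conicalBase) (E : conicalDeformation R),
    (exists n (e : 'I_n -> R), forall x, exists c : 'I_n -> k,
       x = \sum_i c i *: e i) ->
    exists chi, classifies D E chi /\
      forall chi', classifies D E chi' -> chi' =1 chi.
End Deformations.

Definition is_Sym (V : lmodType k) (P : comAlgType k) (i : {linear V -> P}) :=
  forall (C : comAlgType k) (g : {linear V -> C}),
    exists G : {lrmorphism P -> C}, (forall v, G (i v) = g v) /\
      forall G' : {lrmorphism P -> C}, (forall v, G' (i v) = g v) -> G' =1 G.

(* ud_H2 is H_2(X; k), and the base is H^2(X) = Spec Sym H_2(X; k), with linear
   functions in conical degree 2. *)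
Record universalDeformation r (X : conicalHamiltonian r) :=
    UniversalDeformation {
  ud_H2 : vectType k;
  ud_base : conicalBase;
  ud_lin : {linear ud_H2 -> ud_base};
  ud_sym : is_Sym ud_lin;
  ud_lin_gr : forall v, cb_gr 2 (ud_lin v);
  ud_def :> conicalDeformation (ch_con X) ud_base;
  ud_univ : universal ud_def;
  ud_ham : torusAction (lattice r) ud_def;
  ud_ham_comm : commuting (df_act ud_def) ud_ham;
  ud_ham_br : bracket_weight ud_ham 0;
  ud_ham_str : forall a, weightT ud_ham 0 (df_str ud_def a);
  ud_ham_fib : equivariant (ch_ham X) ud_ham (df_fib ud_def);
  ud_wt : int -> lattice r -> set (sec (fullO : opens ud_def)) :=
    fun n l => weightT (df_act ud_def) n `&` weightT ud_ham l;
  ud_sum : direct_sum (fun i : int * lattice r => ud_wt i.1 i.2);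
  ud_neg : forall n l f, n < 0 -> ud_wt n l f -> f = 0 }.
Arguments ud_wt [r X] u n l _.

Definition OX r (X : conicalHamiltonian r) (XX : universalDeformation X) :=
  sec (fullO : opens XX).

Record quantization r (X : conicalHamiltonian r) (XX : universalDeformation X) :=
    Quantization {
  qz_alg :> hamAlgebra k r;
  qz_flat : flat (fun (q : {poly k}) (a : qz_alg) => horner_alg (hbar qz_alg) q * a);
  qz_pi : {rmorphism qz_alg -> OX XX};
  qz_pi_cst : forall c, qz_pi c%:A = cst _ c;
  qz_pi_surj : forall f, exists a, qz_pi a = f;
  qz_pi_ker : forall a, qz_pi a = 0 <-> exists b, a = hbar qz_alg * b;
  qz_pi_gr : forall n l a, hgr n l a -> ud_wt XX n%:Z l (qz_pi a);
  qz_br : forall a b, exists2 c, a * b - b * a = hbar qz_alg * c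
    & qz_pi c = br (qz_pi a) (qz_pi b);
  qz_mom : forall a : qz_alg, hgr 2 0 a ->
    hmom a = @ch_lie r X (pullT (df_fib XX) (qz_pi a));
  qz_H2 : {linear ud_H2 XX -> qz_alg};
  qz_H2_gr : forall v, hgr 2 0 (qz_H2 v);
  qz_H2_pi : forall v, qz_pi (qz_H2 v) = df_str XX (ud_lin XX v);
  qz_mom_ker : forall a : qz_alg, hgr 2 0 a ->
    (hmom a = 0 <-> exists v c, a = qz_H2 v + c *: hbar qz_alg);
  qz_H2_inj : forall v c, qz_H2 v + c *: hbar qz_alg = 0 -> v = 0 /\ c = 0 }.

(* A k-algebra map out of the Frobenius twist of O(XX) is a ring morphism out of
   O(XX) that is semilinear along the Frobenius of k. *)
Record frobeniusConstant p r (X : conicalHamiltonian r)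
    (XX : universalDeformation X) (A : quantization XX) := FrobeniusConstant {
  fc_map :> {rmorphism OX XX -> A};
  fc_frob : forall c f, fc_map (cst _ c * f) = c ^+ p *: fc_map f;
  fc_central : forall f a, fc_map f * a = a * fc_map f;
  fc_pow : forall a, exists b,
    fc_map (qz_pi A a) - a ^+ p = hbar A ^+ p.-1 * b }.
End Schemes.

Section WeightZero.
Variables (k : fieldType) (r : nat) (A : bigradedAlgebra k r).

Lemma hwtB (l : lattice r) (x y : A) : hwt l x -> hwt l y -> hwt l (x - y).
Proof.
move=> hx hy; apply: addspanD => //.
apply: (addspan_map _ _ hy); first by split; [exact: oppr0|exact: opprD].
move=> z [n hz]; exists [:: - z]; last by rewrite big_seq1.
move=> w; rewrite inE => /eqP ->; exists n.
have hgr0 : hgr n l (0 : A) by exact: (ds_0 (hgr_sum A) (n, l)).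
by rewrite -[- z]add0r; exact: (ds_B (hgr_sum A) (i := (n, l))).
Qed.

Lemma hwt0 (l : lattice r) : hwt l (0 : A). Proof. exact: addspan0. Qed.

Lemma hgr_wt n (l : lattice r) (x : A) : hgr n l x -> hwt l x.
Proof.
move=> hx; exists [:: x]; last by rewrite big_seq1.
by move=> y; rewrite inE => /eqP ->; exists n.
Qed.

Lemma hwtZ (l : lattice r) c (x : A) : hwt l x -> hwt l (c *: x).
Proof.
apply: addspan_map; first by split; [exact: scaler0|exact: scalerDr].
by move=> z [n hz]; apply: (@hgr_wt n); exact: hgrZ.
Qed.

Lemma hwtM (l l' : lattice r) (x y : A) :
  hwt l x -> hwt l' y -> hwt (l + l') (x * y).
Proof.
move=> hx hy.
apply: (addspan_map (f := fun z => z * y) _ _ hx).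
  by split; [exact: mul0r | move=> u v; exact: mulrDl].
move=> z [n hz].
apply: (addspan_map (f := fun w => z * w) _ _ hy).
  by split; [exact: mulr0 | move=> u v; exact: mulrDr].
by move=> w [m hw]; apply: (@hgr_wt (n + m)); exact: hgrM.
Qed.

Definition in_A0 : {pred A} := fun x => `[< hwt 0 x >].
Fact in_A0_closed : GRing.subalg_closed in_A0.
Proof.
split.
- by apply/asboolP; apply: (@hgr_wt 0); exact: hgr1.
- move=> c x y /asboolP hx /asboolP hy; apply/asboolP; apply: addspanD => //.
  exact: hwtZ.
- by move=> x y /asboolP hx /asboolP hy; apply/asboolP; rewrite -[0](addr0 0); exact: hwtM.
Qed.
HB.instance Definition _ :=
  GRing.isSubalgClosed.Build k A in_A0 (GRing.subalg_closed_semi in_A0_closed).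
HB.instance Definition _ := GRing.isOppClosed.Build A in_A0
  (GRing.zmod_closedN (GRing.subring_closedB (GRing.subalg_closedBM in_A0_closed))).
Definition A0 := {x : A | in_A0 x}.
HB.instance Definition _ := SubType.on A0.
HB.instance Definition _ := Choice.on A0.
HB.instance Definition _ := [SubChoice_isSubAlgebra of A0 by <:].

Definition in_A02 : {pred A} := fun x => `[< hgr 2 0 x >].
Fact in_A02_closed : GRing.submod_closed in_A02.
Proof.
split; first by apply/asboolP; exact: (ds_0 (hgr_sum A) (2%N, 0)).
move=> c x y /asboolP hx /asboolP hy; apply/asboolP.
rewrite -[y]opprK; apply: (ds_B (hgr_sum A) (i := (2%N, 0))) => /=.
  exact: hgrZ.
by rewrite -scaleN1r; exact: hgrZ.
Qed.
HB.instance Definition _ := GRing.isZmodClosed.Build A in_A02 (GRing.submod_closedB in_A02_closed).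
HB.instance Definition _ := GRing.isScaleClosed.Build k A in_A02 (fun c => (GRing.submod_closed_semi in_A02_closed).2 c).
Definition A02 := {x : A | in_A02 x}.
HB.instance Definition _ := SubType.on A02.
HB.instance Definition _ := Choice.on A02.
HB.instance Definition _ := [SubChoice_isSubLmodule of A02 by <:].
End WeightZero.

Section Cone.
Variables (k : fieldType) (r : nat) (A : bigradedAlgebra k r) (sigma : lattice r).

Definition hplus : set A :=
  addspan [set x | exists n l, (0 < n)%N /\ hgr n l x].
Definition hplus2 : set A :=
  addspan [set x | exists a b, [/\ hplus a, hplus b & x = a * b]].
Definition Sigma_eq : set (lattice r) :=
  [set l | exists x, [/\ hplus x, hwt l x & ~ hplus2 x]].
Definition Sigma_eq_pos : set (lattice r) :=
  [set l | Sigma_eq l /\ 0 < pair_cochar sigma l].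

(* The monoid of non-negative integer combinations of Sigma_eq_pos. *)
Definition in_cone : {pred lattice r} := fun l => `[< addspan Sigma_eq_pos l >].
Fact in_cone_closed : Algebra.addumagma_closed in_cone.
Proof.
split; first by apply/asboolP; exact: addspan0.
by move=> x y /asboolP hx /asboolP hy; apply/asboolP; exact: addspanD.
Qed.
HB.instance Definition _ := GRing.isAddClosed.Build (lattice r) in_cone in_cone_closed.
Definition cone := {l | in_cone l}.
HB.instance Definition _ := Choice.on cone.
HB.instance Definition _ := SubType.on cone.
HB.instance Definition _ :=
  GRing.SubChoice_isSubNmodule.Build (lattice r) in_cone cone in_cone_closed.
End Cone.

Lemma nmod_morphismB (V W : zmodType) (f : V -> W) : nmod_morphism f ->
  forall u v, f (u - v) = f u - f v.
Proof.
by move=> [_ fD] u v; apply/eqP; rewrite eq_sym subr_eq -fD subrK.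
Qed.

Section MalgMap.
Variables (K : choiceType) (G : zmodType).
Implicit Types (f : K -> K) (g : K -> G -> G) (x : {malg G[K]}).

(* The additive map sending << b *g m >> to << g m b *g f m >>. *)
Definition malg_map f g x : {malg G[K]} :=
  \sum_(m <- msupp x) << g m (mcoeff m x) *g f m >>.

Lemma malg_mapU f g b m : (forall m, nmod_morphism (g m)) ->
  malg_map f g << b *g m >> = << g m b *g f m >>.
Proof.
move=> gD; rewrite /malg_map msuppU; case: eqP => [->|_].
  by rewrite big_seq_fset0 (gD m).1 monalgU0.
by rewrite big_seq_fset1 mcoeffUU.
Qed.

Lemma malg_mapD f g : (forall m, nmod_morphism (g m)) ->
  nmod_morphism (malg_map f g).
Proof.
move=> gD; have Ew x (d : {fset K}) : (msupp x `<=` d)%fset ->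
    malg_map f g x = \sum_(m <- d) << g m (mcoeff m x) *g f m >>.
  move=> le; apply: (big_fset_incl _ le) => m md.
  by move=> /mcoeff_outdom ->; rewrite (gD m).1 monalgU0.
split; first by rewrite /malg_map msupp0 big_seq_fset0.
move=> x y; pose d := (msupp x `|` msupp y)%fset.
rewrite (Ew x d) ?fsubsetUl // (Ew y d) ?fsubsetUr // (Ew _ d) ?msuppD_le //.
rewrite -big_split /=; apply: eq_bigr => m _.
by rewrite mcoeffD (gD m).2 monalgUD.
Qed.

Lemma malg_ext (W : nmodType) (F F' : {malg G[K]} -> W) :
  nmod_morphism F -> nmod_morphism F' ->
  (forall b m, F << b *g m >> = F' << b *g m >>) -> F =1 F'.
Proof.
move=> [F0 FD] [F0' FD'] h x; rewrite (monalgE x).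
elim/big_rec: _ => [|m y _ IH]; first by rewrite F0 F0'.
by rewrite FD FD' h IH.
Qed.
End MalgMap.

(* The quotient of {malg G[K]} by the additive subgroup generated by S. *)
Section MalgQuotient.
Variables (K : choiceType) (G : zmodType) (S : set {malg G[K]}).

Definition in_mrel : {pred {malg G[K]}} :=
  fun x => `[< addspan [set y | S y \/ S (- y)] x >].
Fact in_mrel_closed : Algebra.zmod_closed in_mrel.
Proof.
split; first by apply/asboolP; exact: addspan0.
move=> x y /asboolP hx /asboolP hy; apply/asboolP; apply: addspanD => //.
apply: (addspan_map _ _ hy); first by split; [exact: oppr0|exact: opprD].
move=> z hz; exists [:: - z]; last by rewrite big_seq1.
by move=> w; rewrite inE => /eqP ->; rewrite /= opprK; case: hz; [right|left].
Qed.
HB.instance Definition _ :=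
  GRing.isZmodClosed.Build {malg G[K]} in_mrel in_mrel_closed.

Definition malg_quot : Type := Quotient.quot in_mrel.
HB.instance Definition _ := GRing.Zmodule.on malg_quot.
Definition mq_pi (x : {malg G[K]}) : malg_quot := \pi_(Quotient.quot in_mrel) x.
Definition tens (m : K) (b : G) : malg_quot := mq_pi << b *g m >>.

Lemma mq_pi_nmod : nmod_morphism mq_pi.
Proof. by split=> [|x y]; rewrite /mq_pi ?raddf0 ?raddfD. Qed.

Lemma mq_repr (x : malg_quot) : exists y, x = mq_pi y.
Proof. by exists (repr (x : Quotient.quot in_mrel)); rewrite /mq_pi reprK. Qed.

Lemma mq_piP x y : mq_pi x = mq_pi y <-> in_mrel (x - y).
Proof.
rewrite -[in_mrel _]/(x - y \in in_mrel) Quotient.idealrBE.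
by split => /eqP.
Qed.

Lemma mq_pi_rel x : S x -> mq_pi x = 0.
Proof.
move=> Sx; rewrite -(mq_pi_nmod.1); apply/mq_piP; rewrite subr0.
apply/asboolP; exists [:: x]; last by rewrite big_seq1.
by move=> y; rewrite inE => /eqP ->; left.
Qed.

Lemma tens_nmod m : nmod_morphism (tens m).
Proof.
split=> [|x y]; first by rewrite /tens monalgU0 mq_pi_nmod.1.
by rewrite /tens monalgUD mq_pi_nmod.2.
Qed.

Lemma mq_ext (W : nmodType) (F F' : malg_quot -> W) :
  nmod_morphism F -> nmod_morphism F' ->
  (forall m b, F (tens m b) = F' (tens m b)) -> F =1 F'.
Proof.
move=> [F0 FD] [F0' FD'] h x; have [y ->] := mq_repr x.
move: y; apply: malg_ext => [||b m]; last exact: h.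
- by split=> [|u v]; rewrite ?mq_pi_nmod.1 ?F0 // mq_pi_nmod.2 FD.
- by split=> [|u v]; rewrite ?mq_pi_nmod.1 ?F0' // mq_pi_nmod.2 FD'.
Qed.

Section Operators.
Variables (f : K -> K) (g : K -> G -> G).
Hypothesis gD : forall m, nmod_morphism (g m).
Hypothesis fgS : forall x, S x -> mq_pi (malg_map f g x) = 0.

Definition mq_op (x : malg_quot) : malg_quot :=
  mq_pi (malg_map f g (repr (x : Quotient.quot in_mrel))).

Lemma mq_op_pi x : mq_op (mq_pi x) = mq_pi (malg_map f g x).
Proof.
have mB := nmod_morphismB (malg_mapD f gD).
have pB := nmod_morphismB mq_pi_nmod.
apply/eqP; rewrite /mq_op -subr_eq0 -pB -mB; apply/eqP.
have /mq_piP : mq_pi (repr (mq_pi x : Quotient.quot in_mrel)) = mq_pi x.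
  by rewrite /mq_pi reprK.
move: (_ - x) => y /asboolP; move: y; apply: addspan_ind.
  by rewrite (malg_mapD f gD).1 mq_pi_nmod.1.
move=> u v hu hv; rewrite (malg_mapD f gD).2 mq_pi_nmod.2 hv addr0.
case: hu => [/fgS //|/fgS]; rewrite -[- u]add0r mB (malg_mapD f gD).1 pB.
by rewrite mq_pi_nmod.1 sub0r => /eqP; rewrite oppr_eq0 => /eqP.
Qed.

Lemma mq_opE m b : mq_op (tens m b) = tens (f m) (g m b).
Proof. by rewrite /tens mq_op_pi (malg_mapU _ _ _ gD). Qed.

Lemma mq_op_nmod : nmod_morphism mq_op.
Proof.
split; first by rewrite -mq_pi_nmod.1 mq_op_pi (malg_mapD f gD).1.
move=> x y; have [u ->] := mq_repr x; have [v ->] := mq_repr y.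
by rewrite -mq_pi_nmod.2 !mq_op_pi (malg_mapD f gD).2 mq_pi_nmod.2.
Qed.
End Operators.
End MalgQuotient.

Section TwistedTraces.
Variables (k : fieldType) (r : nat) (A : hamAlgebra k r) (sigma : lattice r).
Notation Gam := (@cone k r A sigma).
Notation H0 := (A0 A).
Notation H02 := (A02 A).

Definition hbar2 : H02 := Sub (hbar A) (asboolT (hbar_gr A)).
Lemma A02_A0 (a : H02) : in_A0 (val a).
Proof. by apply/asboolP; apply: hgr_wt; exact: (asboolW (valP a)). Qed.
Definition A02inc (a : H02) : H0 := Sub (val a) (A02_A0 a).

(* a + hbar <l, bar a> *)
Definition shifted (a : H02) (l : lattice r) : H02 :=
  a + pair_lie l (hmom (val a)) *: hbar2.

(* << b *g mu >> is z^mu (x) b. Multiples of the relations by z^mu are written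
   out, and multiples by a scalar are absorbed in a. *)
Definition Meq_rel : set {malg H0[Gam]} :=
  [set m | exists (mu l : Gam) (a b : A) (ab ba : H0),
    [/\ hwt (val l) a, hwt (- val l) b, val ab = a * b, val ba = b * a
      & m = << ab *g mu >> - << ba *g mu + l >>]].
Definition Meq : Type := malg_quot Meq_rel.
HB.instance Definition _ := GRing.Zmodule.on Meq.
Fact mtens_key : unit. Proof. by []. Qed.
Definition mtens : Gam -> H0 -> Meq := locked_with mtens_key (tens Meq_rel).
Lemma mtensE : mtens = tens Meq_rel. Proof. exact: locked_withE. Qed.

Lemma mtens_nmod mu : nmod_morphism (mtens mu).
Proof. by rewrite mtensE; exact: tens_nmod. Qed.

Lemma Meq_ext (W : nmodType) (F F' : Meq -> W) :
  nmod_morphism F -> nmod_morphism F' ->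
  (forall mu b, F (mtens mu b) = F' (mtens mu b)) -> F =1 F'.
Proof. by rewrite mtensE; exact: mq_ext. Qed.

Lemma Meq_relP (mu l : Gam) (a b : A) (ab ba : H0) :
  hwt (val l) a -> hwt (- val l) b -> val ab = a * b -> val ba = b * a ->
  mtens mu ab = mtens (mu + l) ba.
Proof.
move=> ha hb vab vba; apply/eqP; rewrite -subr_eq0 mtensE /tens.
rewrite -(nmod_morphismB (mq_pi_nmod Meq_rel)); apply/eqP/mq_pi_rel.
by exists mu, l, a, b, ab, ba; split.
Qed.

Section Operators.
Variables (f : Gam -> Gam) (g : Gam -> H0 -> H0).
Hypothesis gD : forall mu, nmod_morphism (g mu).
Hypothesis fg_rel : forall (mu l : Gam) (a b : A) (ab ba : H0),
  hwt (val l) a -> hwt (- val l) b -> val ab = a * b -> val ba = b * a ->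
  mtens (f mu) (g mu ab) = mtens (f (mu + l)) (g (mu + l) ba).

Definition Meq_op : Meq -> Meq := @mq_op _ _ Meq_rel f g.

Lemma Meq_op_rel (x : {malg H0[Gam]}) : Meq_rel x -> mq_pi Meq_rel (malg_map f g x) = 0.
Proof.
move=> [mu [l [a [b [ab [ba [ha hb vab vba ->]]]]]]].
rewrite (nmod_morphismB (malg_mapD f gD)) (nmod_morphismB (mq_pi_nmod Meq_rel)).
apply/eqP; rewrite subr_eq0; apply/eqP.
have := fg_rel mu ha hb vab vba; rewrite mtensE /tens => h.
etransitivity; first exact: (congr1 _ (malg_mapU f ab mu gD)).
etransitivity; first exact: h.
symmetry; exact: (congr1 _ (malg_mapU f ba (mu + l) gD)).
Qed.

Lemma Meq_op_tens mu b : Meq_op (mtens mu b) = mtens (f mu) (g mu b).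
Proof. by rewrite mtensE; exact: (mq_opE gD Meq_op_rel). Qed.

Lemma Meq_op_nmod : nmod_morphism Meq_op.
Proof. exact: (mq_op_nmod gD Meq_op_rel). Qed.
End Operators.

Definition Meq_z (nu : Gam) : Meq -> Meq := Meq_op (+%R nu) (fun _ b => b).
Definition Meq_a (a : H02) : Meq -> Meq :=
  Meq_op id (fun mu b => A02inc (shifted a (val mu)) * b).
Definition Meq_c (c : k) : Meq -> Meq := Meq_op id (fun _ b => c *: b).

Let idD (T : nmodType) : nmod_morphism (fun b : T => b). Proof. by []. Qed.
Let mulD (x : H0) : nmod_morphism ( *%R x).
Proof. by split; [exact: mulr0 | exact: mulrDr]. Qed.
Let scaleD (c : k) : nmod_morphism ( *:%R c : H0 -> H0).
Proof. by split; [exact: scaler0 | exact: scalerDr]. Qed.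

Lemma Meq_z_rel nu (mu l : Gam) (a b : A) (ab ba : H0) :
  hwt (val l) a -> hwt (- val l) b -> val ab = a * b -> val ba = b * a ->
  mtens (nu + mu) ab = mtens (nu + (mu + l)) ba.
Proof. by move=> ha hb va vb; rewrite addrA; exact: (Meq_relP _ ha hb). Qed.

Lemma Meq_c_rel c (mu l : Gam) (a b : A) (ab ba : H0) :
  hwt (val l) a -> hwt (- val l) b -> val ab = a * b -> val ba = b * a ->
  mtens mu (c *: ab) = mtens (mu + l) (c *: ba).
Proof.
move=> ha hb va vb; apply: (Meq_relP _ (hwtZ c ha) hb).
  by rewrite linearZ /= va scalerAl.
by rewrite linearZ /= vb scalerAr.
Qed.

Lemma pair_lieD (l l' : lattice r) (t : 'rV[k]_r) :
  pair_lie (l + l') t = pair_lie l t + pair_lie l' t.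
Proof.
rewrite /pair_lie -big_split; apply: eq_bigr => i _.
by rewrite mxE rmorphD mulrDl.
Qed.

Lemma pair_lieDr c (l : lattice r) (t t' : 'rV[k]_r) :
  pair_lie l (c *: t + t') = c * pair_lie l t + pair_lie l t'.
Proof.
rewrite /pair_lie mulr_sumr -big_split; apply: eq_bigr => i _.
by rewrite !mxE mulrDr mulrCA.
Qed.

Lemma pair_lie0r (l : lattice r) : pair_lie l (0 : 'rV[k]_r) = 0.
Proof. by rewrite /pair_lie big1 // => i _; rewrite mxE mulr0. Qed.

Lemma val_shifted (a : H02) l :
  val (shifted a l) = val a + pair_lie l (hmom (val a)) *: hbar A.
Proof. by []. Qed.

Lemma shifted_comm (a : H02) (l m : lattice r) (b : A) : hwt l b ->
  val (shifted a m) * b = b * val (shifted a (m + l)).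
Proof.
move=> hb; have := hmom_comm (asboolW (valP a)) hb.
move=> /eqP; rewrite subr_eq => /eqP E.
rewrite !val_shifted mulrDl mulrDr E pair_lieD scalerDl mulrDr.
rewrite -!scalerAl -!scalerAr -!(hbar_central b).
by rewrite -addrA addrC -addrA.
Qed.

Lemma Meq_a_rel (a' : H02) (mu l : Gam) (a b : A) (ab ba : H0) :
  hwt (val l) a -> hwt (- val l) b -> val ab = a * b -> val ba = b * a ->
  mtens mu (A02inc (shifted a' (val mu)) * ab) =
  mtens (mu + l) (A02inc (shifted a' (val (mu + l))) * ba).
Proof.
move=> ha hb va vb; apply: (@Meq_relP mu l (val (shifted a' (val mu)) * a) b) => //.
- by rewrite -[val l]add0r; apply: hwtM => //; exact: asboolW (A02_A0 _).
- by rewrite [LHS]/= va mulrA.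
- by rewrite [LHS]/= vb !mulrA (shifted_comm _ _ hb) raddfD /= addrK.
Qed.

Lemma Meq_zE nu mu b : Meq_z nu (mtens mu b) = mtens (nu + mu) b.
Proof. exact: (Meq_op_tens (fun _ => idD H0) (@Meq_z_rel _)). Qed.
Lemma Meq_aE a mu b :
  Meq_a a (mtens mu b) = mtens mu (A02inc (shifted a (val mu)) * b).
Proof. exact: (Meq_op_tens (fun _ => mulD _) (@Meq_a_rel _)). Qed.
Lemma Meq_cE c mu b : Meq_c c (mtens mu b) = mtens mu (c *: b).
Proof. exact: (Meq_op_tens (fun _ => scaleD _) (@Meq_c_rel _)). Qed.
Lemma Meq_z_nmod nu : nmod_morphism (Meq_z nu).
Proof. exact: (Meq_op_nmod (fun _ => idD H0) (@Meq_z_rel _)). Qed.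
Lemma Meq_a_nmod a : nmod_morphism (Meq_a a).
Proof. exact: (Meq_op_nmod (fun _ => mulD _) (@Meq_a_rel _)). Qed.
Lemma Meq_c_nmod c : nmod_morphism (Meq_c c).
Proof. exact: (Meq_op_nmod (fun _ => scaleD _) (@Meq_c_rel _)). Qed.
(* R_eq is presented as a k-algebra by generators z^mu and a in A^2_0: rrel is the
   least congruence containing the axioms of k-algebras, those making z
   multiplicative and a |-> Ra a linear with commuting values, and the relation
   a z^mu = z^mu (a + hbar <mu, bar a>). *)
Inductive rterm :=
  | Rc of k | Rz of Gam | Ra of H02 | Radd of rterm & rterm | Rmul of rterm & rterm.

Inductive rrel : rterm -> rterm -> Prop :=
  | rrel_refl x : rrel x x
  | rrel_sym x y : rrel x y -> rrel y x
  | rrel_trans x y z : rrel x y -> rrel y z -> rrel x z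
  | rrel_add x x' y y' : rrel x x' -> rrel y y' -> rrel (Radd x y) (Radd x' y')
  | rrel_mul x x' y y' : rrel x x' -> rrel y y' -> rrel (Rmul x y) (Rmul x' y')
  | rrel_addA x y z : rrel (Radd x (Radd y z)) (Radd (Radd x y) z)
  | rrel_addC x y : rrel (Radd x y) (Radd y x)
  | rrel_add0 x : rrel (Radd (Rc 0) x) x
  | rrel_addN x : rrel (Radd (Rmul (Rc (-1)) x) x) (Rc 0)
  | rrel_mulA x y z : rrel (Rmul x (Rmul y z)) (Rmul (Rmul x y) z)
  | rrel_1mul x : rrel (Rmul (Rc 1) x) x
  | rrel_mul1 x : rrel (Rmul x (Rc 1)) x
  | rrel_mulDl x y z : rrel (Rmul (Radd x y) z) (Radd (Rmul x z) (Rmul y z))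
  | rrel_mulDr x y z : rrel (Rmul x (Radd y z)) (Radd (Rmul x y) (Rmul x z))
  | rrel_cD c d : rrel (Rc (c + d)) (Radd (Rc c) (Rc d))
  | rrel_cM c d : rrel (Rc (c * d)) (Rmul (Rc c) (Rc d))
  | rrel_cC c x : rrel (Rmul (Rc c) x) (Rmul x (Rc c))
  | rrel_z0 : rrel (Rz 0) (Rc 1)
  | rrel_zD mu nu : rrel (Rz (mu + nu)) (Rmul (Rz mu) (Rz nu))
  | rrel_aL c a b : rrel (Ra (c *: a + b)) (Radd (Rmul (Rc c) (Ra a)) (Ra b))
  | rrel_aC a b : rrel (Rmul (Ra a) (Ra b)) (Rmul (Ra b) (Ra a))
  | rrel_az a mu :
      rrel (Rmul (Ra a) (Rz mu)) (Rmul (Rz mu) (Ra (shifted a (val mu)))).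

HB.instance Definition _ := gen_eqMixin rterm.
HB.instance Definition _ := gen_choiceMixin rterm.

Definition rrelb : rel rterm := fun x y => `[< rrel x y >].
Fact rrelb_equiv : equiv_class_of rrelb.
Proof.
split=> [x|x y|y x z].
- exact/asboolP/rrel_refl.
- by apply/asboolP/asboolP; exact: rrel_sym.
- by move=> /asboolP h /asboolP h'; apply/asboolP; exact: rrel_trans h h'.
Qed.
Canonical rrelb_equivRel := EquivRelPack rrelb_equiv.

Definition Req : Type := {eq_quot rrelb}.
HB.instance Definition _ := Choice.on Req.
HB.instance Definition _ := EqQuotient.on Req.

Definition Req_of (x : rterm) : Req := \pi_Req x.
Lemma Req_ofP x y : rrel x y -> Req_of x = Req_of y.
Proof. by move=> h; apply/eqmodP/asboolP. Qed.
Lemma Req_of_rel x y : Req_of x = Req_of y -> rrel x y.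
Proof. by move=> /eqmodP/asboolP. Qed.
Lemma Req_ofK (x : Req) : Req_of (repr x) = x. Proof. exact: reprK. Qed.

Definition Req_add (x y : Req) := Req_of (Radd (repr x) (repr y)).
Definition Req_mul (x y : Req) := Req_of (Rmul (repr x) (repr y)).
Definition Req_opp (x : Req) := Req_of (Rmul (Rc (-1)) (repr x)).

Lemma Req_addE x y : Req_add (Req_of x) (Req_of y) = Req_of (Radd x y).
Proof. by apply/Req_ofP/rrel_add; apply/Req_of_rel; rewrite Req_ofK. Qed.
Lemma Req_mulE x y : Req_mul (Req_of x) (Req_of y) = Req_of (Rmul x y).
Proof. by apply/Req_ofP/rrel_mul; apply/Req_of_rel; rewrite Req_ofK. Qed.
Lemma Req_oppE x : Req_opp (Req_of x) = Req_of (Rmul (Rc (-1)) x).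
Proof.
by apply/Req_ofP/rrel_mul; [exact: rrel_refl|apply/Req_of_rel; rewrite Req_ofK].
Qed.

Fact Req_addA : associative Req_add.
Proof.
move=> x y z; rewrite -[x]Req_ofK -[y]Req_ofK -[z]Req_ofK !Req_addE.
exact/Req_ofP/rrel_addA.
Qed.
Fact Req_addC : commutative Req_add.
Proof.
by move=> x y; rewrite -[x]Req_ofK -[y]Req_ofK !Req_addE; exact/Req_ofP/rrel_addC.
Qed.
Fact Req_add0 : left_id (Req_of (Rc 0)) Req_add.
Proof. by move=> x; rewrite -[x]Req_ofK Req_addE; exact/Req_ofP/rrel_add0. Qed.
Fact Req_addN : left_inverse (Req_of (Rc 0)) Req_opp Req_add.
Proof.
by move=> x; rewrite -[x]Req_ofK Req_oppE Req_addE; exact/Req_ofP/rrel_addN.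
Qed.
Fact Req_mulA : associative Req_mul.
Proof.
move=> x y z; rewrite -[x]Req_ofK -[y]Req_ofK -[z]Req_ofK !Req_mulE.
exact/Req_ofP/rrel_mulA.
Qed.
Fact Req_1mul : left_id (Req_of (Rc 1)) Req_mul.
Proof. by move=> x; rewrite -[x]Req_ofK Req_mulE; exact/Req_ofP/rrel_1mul. Qed.
Fact Req_mul1 : right_id (Req_of (Rc 1)) Req_mul.
Proof. by move=> x; rewrite -[x]Req_ofK Req_mulE; exact/Req_ofP/rrel_mul1. Qed.
Fact Req_mulDl : left_distributive Req_mul Req_add.
Proof.
move=> x y z; rewrite -[x]Req_ofK -[y]Req_ofK -[z]Req_ofK.
by rewrite !(Req_addE, Req_mulE); exact/Req_ofP/rrel_mulDl.
Qed.
Fact Req_mulDr : right_distributive Req_mul Req_add.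
Proof.
move=> x y z; rewrite -[x]Req_ofK -[y]Req_ofK -[z]Req_ofK.
by rewrite !(Req_addE, Req_mulE); exact/Req_ofP/rrel_mulDr.
Qed.
HB.instance Definition _ := GRing.isPzRing.Build Req Req_addA Req_addC Req_add0
  Req_addN Req_mulA Req_1mul Req_mul1 Req_mulDl Req_mulDr.

Fixpoint rterm_act (t : rterm) : Meq -> Meq :=
  match t with
  | Rc c => Meq_c c
  | Rz mu => Meq_z mu
  | Ra a => Meq_a a
  | Radd s t => fun x => rterm_act s x + rterm_act t x
  | Rmul s t => fun x => rterm_act s (rterm_act t x)
  end.

Let actE := (Meq_cE, Meq_zE, Meq_aE).

Lemma rterm_act_nmod t : nmod_morphism (rterm_act t).
Proof.
elim: t => [c|mu|a|s [s0 sD] t [t0 tD]|s [s0 sD] t [t0 tD]] /=.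
- exact: Meq_c_nmod.
- exact: Meq_z_nmod.
- exact: Meq_a_nmod.
- by split=> [|x y]; rewrite ?s0 ?t0 ?addr0 // sD tD addrACA.
- by split=> [|x y]; rewrite ?t0 ?s0 // tD sD.
Qed.

Lemma A02inc_lin c (a b : H02) :
  A02inc (c *: a + b) = c *: A02inc a + A02inc b.
Proof. exact: val_inj. Qed.

Lemma shifted_lin c (a b : H02) l :
  shifted (c *: a + b) l = c *: shifted a l + shifted b l.
Proof.
have E : hmom (val (c *: a + b)) = c *: hmom (val a) + hmom (val b).
  exact: (hmom_lin c (asboolW (valP a)) (asboolW (valP b))).
by rewrite /shifted E pair_lieDr scalerDl scalerDr -scalerA addrACA.
Qed.

Lemma shifted_shifted (a : H02) l m : shifted (shifted a l) m = shifted a (l + m).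
Proof.
have E : hmom (val (shifted a l)) = hmom (val a).
  rewrite val_shifted addrC (hmom_lin _ (hbar_gr A) (asboolW (valP a))).
  by rewrite hmom_hbar scaler0 add0r.
by rewrite {1}/shifted E /shifted pair_lieD scalerDl addrA.
Qed.

Lemma A02_comm (a b : H02) l :
  A02inc (shifted a l) * A02inc (shifted b l) =
  A02inc (shifted b l) * A02inc (shifted a l).
Proof.
apply: val_inj; rewrite /=.
have hb : hwt 0 (val (shifted b l)) := asboolW (A02_A0 _).
have := hmom_comm (asboolW (valP (shifted a l))) hb.
have -> : pair_lie 0 (hmom (val (shifted a l))) = 0.
  by rewrite /pair_lie big1 // => i _; rewrite mxE mul0r.
by rewrite scale0r => /eqP; rewrite subr_eq0 => /eqP.
Qed.

Lemma Meq_c0 x : Meq_c 0 x = 0.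
Proof.
have h0 : nmod_morphism (fun _ : Meq => 0 : Meq) by split=> [|? ?]; rewrite ?addr0.
move: x; apply: (Meq_ext (Meq_c_nmod 0) h0) => mu b.
by rewrite Meq_cE scale0r (mtens_nmod mu).1.
Qed.

Lemma Meq_c1 x : Meq_c 1 x = x.
Proof.
move: x; apply: (Meq_ext (Meq_c_nmod 1) (idD Meq)) => mu b.
by rewrite Meq_cE scale1r.
Qed.

Lemma Meq_cD c d x : Meq_c (c + d) x = Meq_c c x + Meq_c d x.
Proof.
move: x; apply: (Meq_ext (Meq_c_nmod _) (rterm_act_nmod (Radd (Rc c) (Rc d)))).
by move=> mu b; rewrite /= !Meq_cE scalerDl (mtens_nmod mu).2.
Qed.

Lemma Meq_cM c d x : Meq_c (c * d) x = Meq_c c (Meq_c d x).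
Proof.
move: x; apply: (Meq_ext (Meq_c_nmod _) (rterm_act_nmod (Rmul (Rc c) (Rc d)))).
by move=> mu b; rewrite /= !Meq_cE scalerA.
Qed.

Lemma Meq_cC c t x : Meq_c c (rterm_act t x) = rterm_act t (Meq_c c x).
Proof.
elim: t x => [d|mu|a|s IHs t IHt|s IHs t IHt] x /=.
- by rewrite -!Meq_cM mulrC.
- move: x; apply: (Meq_ext (rterm_act_nmod (Rmul (Rc c) (Rz mu)))
    (rterm_act_nmod (Rmul (Rz mu) (Rc c)))) => nu b.
  by rewrite /= Meq_zE !Meq_cE Meq_zE.
- move: x; apply: (Meq_ext (rterm_act_nmod (Rmul (Rc c) (Ra a)))
    (rterm_act_nmod (Rmul (Ra a) (Rc c)))) => nu b.
  by rewrite /= Meq_aE !Meq_cE Meq_aE scalerAr.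
- by rewrite (Meq_c_nmod c).2 IHs IHt.
- by rewrite IHs IHt.
Qed.

Lemma rterm_act_rel s t : rrel s t -> rterm_act s =1 rterm_act t.
Proof.
elim=> {s t}.
- by [].
- by move=> x y _ h m; rewrite h.
- by move=> x y z _ h _ h' m; rewrite h.
- by move=> x x' y y' _ h _ h' m /=; rewrite h h'.
- by move=> x x' y y' _ h _ h' m /=; rewrite h' h.
- by move=> x y z m /=; rewrite addrA.
- by move=> x y m /=; rewrite addrC.
- by move=> x m /=; rewrite Meq_c0 add0r.
- move=> x m /=; rewrite Meq_c0; move: (rterm_act x m) => y.
  by rewrite -{2}[y]Meq_c1 -Meq_cD addNr Meq_c0.
- by [].
- by move=> x m /=; rewrite Meq_c1.
- by move=> x m /=; rewrite Meq_c1.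
- by [].
- by move=> x y z m /=; rewrite (rterm_act_nmod x).2.
- by move=> c d m; exact: Meq_cD.
- by move=> c d m; exact: Meq_cM.
- by move=> c x m; exact: Meq_cC.
- move=> m /=; rewrite Meq_c1; move: m.
  by apply: (Meq_ext (Meq_z_nmod 0) (idD Meq)) => mu b; rewrite Meq_zE add0r.
- move=> mu nu.
  apply: (Meq_ext (rterm_act_nmod (Rz _)) (rterm_act_nmod (Rmul (Rz _) (Rz _)))) => la b.
  by rewrite /= !Meq_zE addrA.
- move=> c a b.
  apply: (Meq_ext (rterm_act_nmod (Ra _))
    (rterm_act_nmod (Radd (Rmul (Rc c) (Ra a)) (Ra b)))) => mu x.
  rewrite /= !Meq_aE Meq_cE shifted_lin A02inc_lin mulrDl -scalerAl.
  by rewrite (mtens_nmod mu).2.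
- move=> a b.
  apply: (Meq_ext (rterm_act_nmod (Rmul (Ra a) (Ra b)))
    (rterm_act_nmod (Rmul (Ra b) (Ra a)))) => mu x.
  by rewrite /= !Meq_aE !mulrA A02_comm.
- move=> a mu.
  apply: (Meq_ext (rterm_act_nmod (Rmul (Ra a) (Rz mu)))
    (rterm_act_nmod (Rmul (Rz mu) (Ra _)))) => nu x.
  by rewrite /= Meq_zE !Meq_aE Meq_zE shifted_shifted.
Qed.

Definition Req_act (D : Req) : Meq -> Meq := rterm_act (repr D).

Lemma Req_actE t m : Req_act (Req_of t) m = rterm_act t m.
Proof. by apply: rterm_act_rel; apply: Req_of_rel; rewrite Req_ofK. Qed.

Fact Req_act_mul (D E : Req) m : Req_act D (Req_act E m) = Req_act (D * E) m.
Proof. by rewrite -[D]Req_ofK -[E]Req_ofK [_ * _]Req_mulE !Req_actE. Qed.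
Fact Req_act1 : left_id 1 Req_act.
Proof. by move=> m; rewrite -[1]/(Req_of (Rc 1)) Req_actE /= Meq_c1. Qed.
Fact Req_actDr : right_distributive Req_act +%R.
Proof. by move=> D x y; exact: (rterm_act_nmod (repr D)).2. Qed.
Fact Req_actDl m : {morph Req_act^~ m : D E / D + E}.
Proof.
by move=> D E; rewrite -[D]Req_ofK -[E]Req_ofK [_ + _]Req_addE !Req_actE.
Qed.
HB.instance Definition _ := GRing.Zmodule_isLmodule.Build Req Meq
  Req_act_mul Req_act1 Req_actDr Req_actDl.

Definition Req_z (mu : Gam) : Req := Req_of (Rz mu).
Definition Req_a (a : H02) : Req := Req_of (Ra a).

Lemma Req_zaE mu a nu b : (Req_z mu * Req_a a) *: mtens nu b =
  mtens (nu + mu) (A02inc (shifted a (val nu)) * b).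
Proof.
rewrite -scalerA [Req_a a *: _]Req_actE [Req_z mu *: _]Req_actE /=.
by rewrite Meq_aE Meq_zE addrC.
Qed.
End TwistedTraces.

(* Main.v *)
Require Import Defs.
From HB Require Import structures.
From mathcomp Require Import all_boot all_order all_algebra.
From mathcomp Require Import boolp classical_sets topology_structure.
From mathcomp Require Import finmap monalg.
Import Order.TTheory GRing.Theory Num.Theory.
Set Implicit Arguments.
Unset Strict Implicit.
Unset Printing Implicit Defensive.
Local Open Scope ring_scope.

(** Two properties of Lambda(a) are used: it is central in the quantization, and
    it has torus weight p * 0 = 0. The twisted trace relation identifies
    z^mu (x) x y with z^(mu + l) (x) y x, for x of weight l and y of weight - l.
    A central element c of weight zero can be absorbed in x without changing its
    weight, and c (y x) = y (c x), so multiplication by c maps a relation to the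
    relation of the pair (c x, y): it descends to the quotient
    ([Meq_central_rel]). On the generators of the ring of differential operators
    the commutation is then visible: z^nu only changes the first tensor factor,
    scalars commute with everything, and an element of A^2_0 acts by left
    multiplication by an element of A_0, which commutes with c
    ([Meq_central_Req]). *)

Section CentralMultiplication.
Variables (k : fieldType) (r : nat) (A : hamAlgebra k r) (sigma : 'rV[int]_r).
Variable c : A0 A.
Hypothesis c_central : forall x : A, val c * x = x * val c.

Let mulc (_ : @cone k r A sigma) (b : A0 A) := c * b.

Let mulcD mu : nmod_morphism (mulc mu).
Proof. by split; [exact: mulr0 | exact: mulrDr]. Qed.

(** Weight zero of [c] keeps [c * x] in the weight space of [x], and centrality
    identifies [y * (c * x)] with [c * (y * x)]. *)
Lemma Meq_central_rel (mu l : @cone k r A sigma) (x y : A) (xy yx : A0 A) :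
  hwt (val l) x -> hwt (- val l) y -> val xy = x * y -> val yx = y * x ->
  mtens mu (c * xy) = mtens (mu + l) (c * yx).
Proof.
move=> hx hy vxy vyx; apply: (@Meq_relP _ _ _ _ mu l (val c * x) y) => //.
- by rewrite -[val l]add0r; apply: hwtM => //; exact: asboolW (valP c).
- by rewrite [LHS]/= vxy mulrA.
- by rewrite [LHS]/= vyx !mulrA c_central.
Qed.

Definition Meq_central : Meq A sigma -> Meq A sigma := Meq_op id mulc.

Lemma Meq_centralE mu b : Meq_central (mtens mu b) = mtens mu (c * b).
Proof. exact: (Meq_op_tens mulcD Meq_central_rel). Qed.

Lemma Meq_central_nmod : nmod_morphism Meq_central.
Proof. exact: (Meq_op_nmod mulcD Meq_central_rel). Qed.

Lemma A0_central (x : A0 A) : c * x = x * c.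
Proof. by apply: val_inj; exact: c_central. Qed.

Lemma Meq_central_rterm (t : rterm A sigma) m :
  Meq_central (rterm_act t m) = rterm_act t (Meq_central m).
Proof.
have [L0 LD] := Meq_central_nmod.
(* Both sides are additive in m, so generators can be tested on pure tensors. *)
have gen u :
    (forall mu b, Meq_central (rterm_act u (mtens mu b)) =
                  rterm_act u (Meq_central (mtens mu b))) ->
    forall x, Meq_central (rterm_act u x) = rterm_act u (Meq_central x).
  have [u0 uD] := rterm_act_nmod u.
  apply: Meq_ext; first by split=> [|x y]; rewrite ?u0 ?L0 ?uD ?LD.
  by split=> [|x y]; rewrite ?L0 ?u0 ?LD ?uD.
elim: t m => [d|nu|a|s IHs t IHt|s IHs t IHt] m.
- apply: gen => mu b /=.
  by rewrite Meq_cE !Meq_centralE Meq_cE scalerAr.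
- apply: gen => mu b /=.
  by rewrite Meq_zE !Meq_centralE Meq_zE.
- apply: gen => mu b /=.
  by rewrite Meq_aE !Meq_centralE Meq_aE !mulrA A0_central.
- by rewrite /= LD IHs IHt.
- by rewrite /= IHs IHt.
Qed.

(** The action of an operator is that of a term representing it, so it is enough
    to treat terms in the generators, by induction. *)
Lemma Meq_central_Req (D : Req A sigma) (m : Meq A sigma) :
  Meq_central (D *: m) = D *: Meq_central m.
Proof. exact: Meq_central_rterm. Qed.

End CentralMultiplication.

Theorem proposition1p1 (k : fieldType) (p : nat) (hp : p \in [pchar k]) (r : nat)
    (X : conicalHamiltonian k r) (XX : universalDeformation X)
    (A : quantization XX) (sigma : 'rV[int]_r)
    (Lambda : frobeniusConstant p A)
    (hLambda : forall (l : 'rV[int]_r) (f : OX XX),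
       weightT (ud_ham XX) l f -> hwt (l *+ p) (Lambda f))
    (a : OX XX) (ha : weightT (ud_ham XX) 0 a) :
  exists La : A0 A, val La = Lambda a /\
  exists L : {additive Meq A sigma -> Meq A sigma},
    (forall mu b, L (mtens mu b) = mtens mu (La * b)) /\
    (forall (D : Req A sigma) (m : Meq A sigma), L (D *: m) = D *: L m).
Proof.
have La0 : in_A0 (Lambda a : A).
  by apply/asboolP; have := hLambda 0 a ha; rewrite mul0rn.
pose La : A0 A := Sub (Lambda a : A) La0.
have La_central (x : A) : val La * x = x * val La by exact: fc_central.
exists La; split=> //.
pose h := GRing.isNmodMorphism.Build _ _ _ (Meq_central_nmod sigma La_central).
pose L : {additive Meq A sigma -> Meq A sigma} :=
  HB.pack (@Meq_central _ _ _ sigma La) h.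
exists L; split.
- exact: Meq_centralE.
- exact: Meq_central_Req.
Qed.
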